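(* Let $\eta\in\mathbb C\setminus\{0\}$ and let $V_{\lambda_1}(\delta_1)$, $V_{\lambda_2}(\delta_2)$ be finite-dimensional evaluation representations ($2\lambda_1,2\lambda_2\in\mathbb N_0$). Consider the operator $F_{12}$ on $V_{\lambda_1}(\delta_1)\otimes V_{\lambda_2}(\delta_2)$, $$F_{12}=Q_{12}\sum_{n\ge0}\tfrac{\eta^n}{n!}\Bigl(\prod_{j=1}^n\bigl(\delta_1-\delta_2+\eta(H\otimes1-1\otimes H)+\eta j\bigr)^{-1}\Bigr)F^n\otimes E^n,\qquad Q_{12}^{-1}|\ell,k\rangle=\prod_{j=0}^{k-1}\frac{\delta_1-\delta_2+\eta(\lambda_1-\lambda_2-\ell+j)}{\delta_1-\delta_2+\eta(-\lambda_1-\lambda_2+j)}\,|\ell,k\rangle,$$ whose matrix coefficients are regarded as rational functions of $\delta_1-\delta_2$ (with common factors cancelled). Then $F_{12}$ is well-defined (no matrix coefficient has a pole) on $V_{\lambda_1}(\delta_1)\otimes V_{\lambda_2}(\delta_2)$ if and only if $$\frac{\delta_1-\delta_2}{\eta}\notin\{-\lambda_1-\lambda_2+1,\,-\lambda_1-\lambda_2+2,\,\dots,\,\lambda_1+\lambda_2-1\}.$$ In particular there exist irreducible representations $V_{\lambda_1}(\delta_1)\otimes V_{\lambda_2}(\delta_2)$ for which $F_{12}$ does not exist.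
   Context: For $2\lambda\in\mathbb N_0$, $V_\lambda$ is the $(2\lambda+1)$-dimensional irreducible $\mathfrak{sl}_2$-representation with basis $|k\rangle$, $0\le k\le2\lambda$, $H|k\rangle=(\lambda-k)|k\rangle$, $E|k\rangle=k|k-1\rangle$, $F|k\rangle=(2\lambda-k)|k+1\rangle$. $|\ell,k\rangle=|\ell\rangle\otimes|k\rangle$ is the basis of $V_{\lambda_1}\otimes V_{\lambda_2}$ in which matrix coefficients are taken. The evaluation representation $V_\lambda(\delta)$ of the Yangian is $V_\lambda$ with operators ($u\in\mathbb C$) $A(u)=u-\delta+\eta H$, $B(u)=\eta F$, $C(u)=\eta E$, $D(u)=u-\delta-\eta H$; the tensor product $V_{\lambda_1}(\delta_1)\otimes V_{\lambda_2}(\delta_2)$ is a representation via $\Delta A=A\otimes A+C\otimes B$, $\Delta B=B\otimes A+D\otimes B$, $\Delta C=A\otimes C+C\otimes D$, $\Delta D=B\otimes C+D\otimes D$. It is irreducible if no proper nonzero subspace is invariant under all $\Delta A(u),\Delta B(u),\Delta C(u),\Delta D(u)$, $u\in\mathbb C$.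
   Formalization: The ''only if'' half fails when exactly one of λ1, λ2 is 0 and the other is at least 1 (then F12 is the identity, but the exceptional set is nonempty), so the equivalence is stated without those pairs; the ''if'' half is kept for all spins. *)

(* Defs.v *)
From HB Require Import structures.
From mathcomp Require Import all_boot all_order all_algebra.
From mathcomp Require Import fraction complex mxtens reals.

Set Implicit Arguments.
Unset Strict Implicit.
Unset Printing Implicit Defensive.

Import GRing.Theory.
Local Open Scope ring_scope.

(* A spin lambda with 2 lambda in N is encoded by the natural number
   m = 2 lambda, and V_lambda is the space of columns 'cV_m.+1, with |k> the
   k-th unit column.  An operator T is the matrix acting on columns from the
   left, so T i k is the coefficient of |i> in T|k> and composition is the
   matrix product. *)

Definition spin (K : fieldType) (m : nat) : K := m%:R / 2%:R.

Definition opH (K : fieldType) (m : nat) : 'M[K]_m.+1 :=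
  \matrix_(i, k) (if i == k then spin K m - k%:R else 0).

Definition opE (K : fieldType) (m : nat) : 'M[K]_m.+1 :=
  \matrix_(i, k) (if i.+1 == k :> nat then k%:R else 0).

Definition opF (K : fieldType) (m : nat) : 'M[K]_m.+1 :=
  \matrix_(i, k) (if i == k.+1 :> nat then m%:R - k%:R else 0).

Record yangian_ops (K : fieldType) (n : nat) := YangianOps {
  opA : K -> 'M[K]_n;
  opB : K -> 'M[K]_n;
  opC : K -> 'M[K]_n;
  opD : K -> 'M[K]_n
}.

Definition evaluation_rep (K : fieldType) (eta : K) (m : nat) (delta : K) :
    yangian_ops K m.+1 :=
  {| opA := fun u => (u - delta)%:M + eta *: opH K m;
     opB := fun=> eta *: opF K m;
     opC := fun=> eta *: opE K m;
     opD := fun u => (u - delta)%:M - eta *: opH K m |}.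

Definition tensor_rep (K : fieldType) (n1 n2 : nat)
    (V : yangian_ops K n1) (W : yangian_ops K n2) : yangian_ops K (n1 * n2) :=
  {| opA := fun u => opA V u *t opA W u + opC V u *t opB W u;
     opB := fun u => opB V u *t opA W u + opD V u *t opB W u;
     opC := fun u => opA V u *t opC W u + opC V u *t opD W u;
     opD := fun u => opB V u *t opC W u + opD V u *t opD W u |}.

Definition invariant_under (K : fieldType) (n : nat)
    (W : {vspace 'cV[K]_n}) (T : 'M[K]_n) : Prop :=
  forall v : 'cV[K]_n, v \in W -> T *m v \in W.

Definition irreducible_rep (K : fieldType) (n : nat) (V : yangian_ops K n) :
    Prop :=
  forall W : {vspace 'cV[K]_n},
    (forall u : K, [/\ invariant_under W (opA V u), invariant_under W (opB V u),
                       invariant_under W (opC V u)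
                     & invariant_under W (opD V u)]) ->
    W = 0%VS \/ W = fullv.

(* In Q12inv and F12, x stands for delta_1 - delta_2, m1 = 2 lambda_1 and
   m2 = 2 lambda_2.  The basis vector |l, k> has index mxtens_index (l, k). *)

Definition Q12inv (K : fieldType) (eta x : K) (m1 m2 : nat) :
    'M[K]_(m1.+1 * m2.+1) :=
  diag_mx (\row_i
    let l := (mxtens_unindex i).1 in
    let k := (mxtens_unindex i).2 in
    \prod_(j < k)
      ((x + eta * (spin K m1 - spin K m2 - l%:R + j%:R)) /
       (x + eta * (- spin K m1 - spin K m2 + j%:R)))).

Definition F12_term (K : fieldType) (eta x : K) (m1 m2 n : nat) :
    'M[K]_(m1.+1 * m2.+1) :=
  (eta ^+ n / n`!%:R) *:
    ((\prod_(1 <= j < n.+1)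
        invmx (x%:M + eta *: (opH K m1 *t 1%:M - 1%:M *t opH K m2)
               + (eta * j%:R)%:M)) *m
     ((opF K m1 ^+ n) *t (opE K m2 ^+ n))).

(* The terms with n > 2 lambda_1 vanish, see F12_term_eq0. *)
Definition F12 (K : fieldType) (eta x : K) (m1 m2 : nat) :
    'M[K]_(m1.+1 * m2.+1) :=
  invmx (Q12inv eta x m1 m2) *m \sum_(n < m1.+1) F12_term eta x m1 m2 n.

Lemma opFX_support (K : fieldType) (m n : nat) (i k : 'I_m.+1) :
  (i < n)%N -> (opF K m ^+ n) i k = 0.
Proof.
elim: n i k => // n IHn i k lt_in.
rewrite exprS mxE big1 // => j _; rewrite mxE.
case: eqP => [eq_ij|_]; last by rewrite mul0r.
by rewrite IHn ?mulr0 // -ltnS -eq_ij.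
Qed.

Lemma F12_term_eq0 (K : fieldType) (eta x : K) (m1 m2 n : nat) :
  (m1 < n)%N -> F12_term eta x m1 m2 n = 0.
Proof.
move=> lt_mn; rewrite /F12_term.
suff -> : opF K m1 ^+ n = 0 by rewrite tens0mx mulmx0 scaler0.
apply/matrixP=> i k; rewrite mxE opFX_support //.
by apply: leq_trans lt_mn; rewrite ltn_ord.
Qed.

Definition has_pole (K : fieldType) (f : {fraction {poly K}}) (a : K) : Prop :=
  exists p q : {poly K},
    [/\ q != 0, coprimep p q, f = @FracField.tofrac _ p / @FracField.tofrac _ q
      & root q a].

(* F12 over the field of rational functions in the variable delta_1 - delta_2 *)
Definition F12_rational (K : fieldType) (eta : K) (m1 m2 : nat) :
    'M[{fraction {poly K}}]_(m1.+1 * m2.+1) :=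
  F12 (@FracField.tofrac {poly K} eta%:P) (@FracField.tofrac {poly K} 'X) m1 m2.

Definition F12_well_defined (K : fieldType) (eta : K) (m1 m2 : nat)
    (delta1 delta2 : K) : Prop :=
  forall i j, ~ has_pole (F12_rational eta m1 m2 i j) (delta1 - delta2).

(* - lambda_1 - lambda_2 + 1, ..., lambda_1 + lambda_2 - 1 in steps of 1
   (m1 + m2 - 1 values, hence none if m1 + m2 <= 1) *)
Definition exceptional_values (K : fieldType) (m1 m2 : nat) : seq K :=
  [seq - spin K m1 - spin K m2 + 1 + i%:R | i <- iota 0 (m1 + m2).-1%N].

(* Main.v *)
(* Put y = (delta_1 - delta_2) / eta and s = y + lambda_1 + lambda_2, so that the
   exceptional values are s = 1, ..., m1 + m2 - 1.  A nonzero coefficient of F_12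
   in row |l, k> coming from F^n (x) E^n, which forces n <= l and k + n <= m2, is
   a nonzero constant times a product of simple factors; its denominator vanishes
   only at s = m2 + l - j with 0 <= j <= k + n and j <> k.  These values lie in
   1, ..., m1 + m2 - 1, except for s = m1 + m2 when l = m1 and j = 0, where the
   numerator of Q_12 cancels the factor.  Conversely, when m1, m2 > 0, every
   exceptional s is already a pole of a diagonal coefficient, to which only n = 0
   contributes: take l = 0, k = m2 - s + 1 if s <= m2, and l = s - m2, k = 1
   otherwise. *)
Require Import Defs.
From HB Require Import structures.
From mathcomp Require Import all_boot all_order all_algebra.
From mathcomp Require Import fraction complex mxtens reals.
From mathcomp Require Import ring zify.

Import Order.TTheory GRing.Theory Num.Theory.
Local Open Scope ring_scope.

(** * Inverses and products of diagonal matrices *)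

Section DiagonalMatrices.

Context {K : fieldType} {n : nat}.

Lemma invmx_diag (d : 'rV[K]_n) :
  (forall i, d 0 i != 0) ->
  invmx (diag_mx d) = diag_mx (\row_i (d 0 i)^-1).
Proof.
move=> d_neq0.
have dV : diag_mx d *m diag_mx (\row_i (d 0 i)^-1) = 1%:M.
  rewrite mulmx_diag -diag_const_mx; congr diag_mx.
  by apply/rowP=> i; rewrite !mxE divff.
have [d_unit _] := mulmx1_unit dV.
by rewrite -[RHS](mulKmx d_unit) dV mulmx1.
Qed.

Lemma prod_diag_mx (I : Type) (r : seq I) (d : I -> 'rV[K]_n) :
  \prod_(i <- r) diag_mx (d i) = diag_mx (\row_k \prod_(i <- r) d i 0 k).
Proof.
elim: r => [|i r IHr].
  rewrite big_nil -[1]/(1%:M) -diag_const_mx; congr diag_mx.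
  by apply/rowP=> k; rewrite !mxE big_nil.
rewrite big_cons IHr -[LHS]/(_ *m _) mulmx_diag; congr diag_mx.
by apply/rowP=> k; rewrite !mxE big_cons.
Qed.

End DiagonalMatrices.

Lemma opEX_support (K : fieldType) (m n : nat) (i k : 'I_m.+1) :
  (i + n)%N != k -> (opE K m ^+ n) i k = 0.
Proof.
elim: n i => [|n IHn] i neq_ik.
  by rewrite expr0 mxE -val_eqE /= -[i : nat]addn0 (negPf neq_ik).
rewrite exprS mxE big1 // => j _; rewrite mxE.
case: eqP => [eq_ij|_]; last by rewrite mul0r.
by rewrite IHn ?mulr0 // -eq_ij addSnnS.
Qed.

(** * Poles and regularity of rational functions *)

Section Poles.

Context {K : fieldType}.
Implicit Types (f g : {fraction {poly K}}) (a : K).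

(** Unlike in [has_pole], the fraction need not be reduced, so closure under sums and products is
    plain fraction arithmetic. *)
Definition regular_at a f : Prop :=
  exists p q : {poly K},
    ~~ root q a /\ f = @FracField.tofrac _ p / @FracField.tofrac _ q.

Lemma nonroot_neq0 (q : {poly K}) a : ~~ root q a -> q != 0.
Proof. by apply: contraNneq => ->; rewrite root0. Qed.

(** Cross-multiplying with the reduced fraction and evaluating at [a] would make [a] a common root
    of its coprime numerator and denominator. *)
Lemma regular_no_pole a f : regular_at a f -> ~ has_pole f a.
Proof.
move=> [p [q [qa ->]]] [p' [q' [q'0 co_pq' eq_f q'a]]].
have q0 := nonroot_neq0 _ _ qa.
have /eqP : p * q' = p' * q.
  apply/eqP; rewrite -tofrac_eq !tofracM; apply/eqP.
  by move/eqP: eq_f; rewrite eqr_div ?tofrac_eq0 // => /eqP.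
move=> /eqP /(congr1 (fun r => r.[a])); rewrite !hornerM (rootP q'a) mulr0.
move=> /esym/eqP; rewrite mulf_eq0 -!/(root _ _) (negPf qa) orbF => p'a.
by have := coprimep_root co_pq' p'a; rewrite (rootP q'a) eqxx.
Qed.

(** The gcd divides [p], so it does not vanish at [a]; cancelling it leaves the root in the reduced
    denominator. *)
Lemma has_pole_frac a (p q : {poly K}) :
  q != 0 -> ~~ root p a -> root q a ->
  has_pole (@FracField.tofrac _ p / @FracField.tofrac _ q) a.
Proof.
move=> q0 pa qa; set d := gcdp p q.
have dE : p = p %/ d * d /\ q = q %/ d * d.
  by rewrite !divpK ?dvdp_gcdl ?dvdp_gcdr.
have [pE qE] := dE.
have d0 : d != 0 by rewrite gcdp_eq0 negb_and q0 orbT.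
have da : ~~ root d a by apply: contra pa; rewrite pE rootM orbC => ->.
have q'0 : q %/ d != 0 by apply: contraNneq q0 => q'0; rewrite qE q'0 mul0r.
exists (p %/ d), (q %/ d); split=> //.
- by apply: coprimep_div_gcd; rewrite q0 orbT.
- rewrite {1}pE {1}qE !tofracM -mulf_div divff ?mulr1 ?tofrac_eq0 //.
- by move: qa; rewrite {1}qE rootM (negPf da) orbF.
Qed.

Lemma regularM a f g : regular_at a f -> regular_at a g -> regular_at a (f * g).
Proof.
move=> [p [q [qa ->]]] [p' [q' [q'a ->]]]; exists (p * p'), (q * q').
by rewrite rootM negb_or qa q'a mulf_div !tofracM.
Qed.

Lemma regularD a f g : regular_at a f -> regular_at a g -> regular_at a (f + g).
Proof.
move=> [p [q [qa ->]]] [p' [q' [q'a ->]]].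
exists (p * q' + p' * q), (q * q'); split; first by rewrite rootM negb_or qa q'a.
rewrite addf_div ?tofrac_eq0 ?tofracD ?tofracM //.
  exact: nonroot_neq0 qa.
exact: nonroot_neq0 q'a.
Qed.

Lemma regular_tofrac a (p : {poly K}) : regular_at a (@FracField.tofrac _ p).
Proof. by exists p, 1; rewrite root1 tofrac1 divr1. Qed.

Lemma regular_prod a (I : eqType) (r : seq I) (F : I -> {fraction {poly K}}) :
  (forall i, i \in r -> regular_at a (F i)) ->
  regular_at a (\prod_(i <- r) F i).
Proof.
move=> reg_F; rewrite big_seq.
by elim/big_ind: _ => //; [rewrite -tofrac1; apply: regular_tofrac|apply: regularM].
Qed.

Lemma regular_sum a (I : eqType) (r : seq I) (F : I -> {fraction {poly K}}) :
  (forall i, i \in r -> regular_at a (F i)) ->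
  regular_at a (\sum_(i <- r) F i).
Proof.
move=> reg_F; rewrite big_seq.
by elim/big_ind: _ => //; [rewrite -tofrac0; apply: regular_tofrac|apply: regularD].
Qed.

End Poles.

(** * Scalars as constant rational functions *)

Section Constants.

Context {K : fieldType}.

Definition cst (c : K) : {fraction {poly K}} := @FracField.tofrac _ c%:P.

HB.instance Definition _ := GRing.RMorphism.copy cst
  (@FracField.tofrac {poly K} \o polyC).

Lemma regular_cst a c : regular_at a (cst c).
Proof. exact: regular_tofrac. Qed.

Lemma cst_spin m : cst (spin K m) = spin {fraction {poly K}} m.
Proof. by rewrite /spin fmorph_div !rmorph_nat. Qed.

Lemma cst_nat n : cst n%:R = n%:R :> {fraction {poly K}}.
Proof. exact: rmorph_nat. Qed.

Lemma cstD c d : cst (c + d) = cst c + cst d.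
Proof. exact: rmorphD. Qed.

Lemma cstN c : cst (- c) = - cst c.
Proof. exact: rmorphN. Qed.

Definition cstE := (cstD, cstN, cst_spin, cst_nat).

Lemma map_opE m : map_mx cst (opE K m) = opE {fraction {poly K}} m.
Proof.
by apply/matrixP=> i k; rewrite !mxE; case: ifP; rewrite ?rmorph_nat ?rmorph0.
Qed.

Lemma map_opF m : map_mx cst (opF K m) = opF {fraction {poly K}} m.
Proof.
apply/matrixP=> i k; rewrite !mxE.
by case: ifP; rewrite ?rmorphB ?rmorph_nat ?rmorph0.
Qed.

End Constants.

(** * Matrix coefficients of F_12 in the tensor basis *)

Section Coefficients.

Context {K : fieldType}.
Variables (eta : K) (m1 m2 : nat).

(** Every linear factor in F_12 has this form; it is built as a polynomial first so that its root
    can be read off. *)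
Definition shifted (c : K) : {fraction {poly K}} :=
  @FracField.tofrac _ ('X + (eta * c)%:P).

Lemma shiftedE c :
  shifted c = @FracField.tofrac _ 'X + @FracField.tofrac _ eta%:P * cst c.
Proof. by rewrite /shifted tofracD polyCM tofracM. Qed.

Lemma root_shifted a c : root ('X + (eta * c)%:P) a = (a + eta * c == 0).
Proof. by rewrite rootE hornerD hornerX hornerC. Qed.

Lemma poly_shifted_neq0 c : 'X + (eta * c)%:P != 0 :> {poly K}.
Proof. by rewrite -size_poly_eq0 size_XaddC. Qed.

Lemma shifted_neq0 c : shifted c != 0.
Proof. by rewrite tofrac_eq0 poly_shifted_neq0. Qed.

Lemma regular_shiftedV a c : a + eta * c != 0 -> regular_at a (shifted c)^-1.
Proof.
move=> ac; exists 1, ('X + (eta * c)%:P).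
by rewrite root_shifted ac tofrac1 div1r.
Qed.

(** The eigenvalue of Q_12 itself on |l, k>, hence the fractions of [Q12inv] inverted. *)
Definition Q12_coef (l k : nat) : {fraction {poly K}} :=
  \prod_(j < k) (shifted (- spin K m1 - spin K m2 + j%:R)
                 / shifted (spin K m1 - spin K m2 - l%:R + j%:R)).

(** The inverse factors act after F^n and E^n, so (l, k) is the row of the coefficient. *)
Definition denom_coef (l k n : nat) : {fraction {poly K}} :=
  \prod_(1 <= j < n.+1)
     (shifted (spin K m1 - l%:R - (spin K m2 - k%:R) + j%:R))^-1.

(** Over rational functions no linear factor is zero, so [invmx] is a genuine inverse and not its
    default value. *)
Lemma invmx_Q12inv :
  invmx (Q12inv (@FracField.tofrac {poly K} eta%:P)
                (@FracField.tofrac {poly K} 'X) m1 m2) =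
  diag_mx (\row_i Q12_coef (mxtens_unindex i).1 (mxtens_unindex i).2).
Proof.
have QE i : (\row_i
    let l := (mxtens_unindex i).1 in
    let k := (mxtens_unindex i).2 in
    \prod_(j < k)
      ((@FracField.tofrac {poly K} 'X + @FracField.tofrac {poly K} eta%:P
          * (spin _ m1 - spin _ m2 - l%:R + j%:R)) /
       (@FracField.tofrac {poly K} 'X + @FracField.tofrac {poly K} eta%:P
          * (- spin _ m1 - spin _ m2 + j%:R)))) 0 i =
    (Q12_coef (@mxtens_unindex m1.+1 m2.+1 i).1 (mxtens_unindex i).2)^-1.
  rewrite !mxE -prodfV; apply: eq_bigr => j _.
  by rewrite invf_div !shiftedE !cstE.
rewrite /Q12inv invmx_diag => [|i].
  by congr diag_mx; apply/rowP=> i; rewrite mxE QE invrK mxE.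
rewrite QE invr_eq0; apply/prodf_neq0 => j _.
by rewrite mulf_neq0 ?invr_eq0 ?shifted_neq0.
Qed.

Lemma F12_termE (n : nat) i j :
  F12_term (@FracField.tofrac {poly K} eta%:P)
           (@FracField.tofrac {poly K} 'X) m1 m2 n i j =
  cst (eta ^+ n / n`!%:R * (opF K m1 ^+ n) (mxtens_unindex i).1 (mxtens_unindex j).1
       * (opE K m2 ^+ n) (mxtens_unindex i).2 (mxtens_unindex j).2)
  * denom_coef (mxtens_unindex i).1 (mxtens_unindex i).2 n.
Proof.
rewrite /F12_term.
under eq_bigr => r _.
  rewrite [X in invmx X](_ : _ = diag_mx (\row_i
     shifted (spin K m1 - (mxtens_unindex i).1%:R
              - (spin K m2 - (@mxtens_unindex m1.+1 m2.+1 i).2%:R) + r%:R))).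
    rewrite invmx_diag; last by move=> k; rewrite mxE shifted_neq0.
    over.
  apply/matrixP=> k k'; rewrite !mxE.
  have [<-|neq_kk'] := eqVneq k k'.
    rewrite !eqxx shiftedE !cstE.
    by rewrite !mulr1n mulr1 mul1r -addrA -mulrDr.
  (* Distinct indices differ in a component, which kills the off-diagonal Kronecker products. *)
  have : ((mxtens_unindex k).1 != (mxtens_unindex k').1)
         || ((mxtens_unindex k).2 != (mxtens_unindex k').2).
    rewrite -negb_and; apply: contra neq_kk' => /andP[/eqP e1 /eqP e2].
    rewrite -[k]mxtens_unindexK -[k']mxtens_unindexK.
    by rewrite [mxtens_unindex k]surjective_pairing e1 e2 -surjective_pairing.
  by case/orP=> /negPf->; rewrite !(mulr0n, mul0r, mulr0, subr0, addr0).
rewrite prod_diag_mx mul_diag_mx !mxE.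
rewrite !(rmorphM cst) (fmorphV cst) (rmorphXn cst) /= cst_nat.
rewrite -map_opE -map_opF -!rmorphXn /= !mxE /denom_coef.
under eq_bigr do rewrite !mxE.
by ring.
Qed.

Lemma F12_rationalE i j :
  F12_rational eta m1 m2 i j =
  Q12_coef (mxtens_unindex i).1 (mxtens_unindex i).2 *
  \sum_(n < m1.+1)
    cst (eta ^+ n / n`!%:R
         * (opF K m1 ^+ n) (mxtens_unindex i).1 (mxtens_unindex j).1
         * (opE K m2 ^+ n) (mxtens_unindex i).2 (mxtens_unindex j).2)
    * denom_coef (mxtens_unindex i).1 (mxtens_unindex i).2 n.
Proof.
rewrite /F12_rational /F12 invmx_Q12inv mul_diag_mx !mxE summxE.
by under eq_bigr do rewrite F12_termE.
Qed.

End Coefficients.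

(** * Comparison of the poles with the exceptional values *)

Section WellDefinedness.

Context {K : numFieldType}.
Variables (eta : K) (m1 m2 : nat).
Hypothesis eta_neq0 : eta != 0.

Lemma spinD m : spin K m + spin K m = m%:R.
Proof. by rewrite -[LHS]mulr2n -[LHS]mulr_natr divfK // pnatr_eq0. Qed.

(** In the coordinate s = a / eta + lambda_1 + lambda_2, the factor with this shift vanishes exactly
    at s = t. The additive hypothesis avoids truncated subtraction. *)
Lemma spin_shift (l j t : nat) :
  (t + j = m2 + l)%N ->
  spin K m1 - spin K m2 - l%:R + j%:R = spin K m1 + spin K m2 - t%:R.
Proof.
move=> /(congr1 (fun n => n%:R : K)); rewrite !natrD => tE.
have -> : t%:R = spin K m2 + spin K m2 + l%:R - j%:R by rewrite spinD -tE addrK.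
by ring.
Qed.

Lemma exceptionalE (a : K) :
  a / eta \in exceptional_values K m1 m2 <->
  exists2 t, (0 < t < m1 + m2)%N
           & a + eta * (spin K m1 + spin K m2 - t%:R) = 0.
Proof.
have aE t : a + eta * (spin K m1 + spin K m2 - t%:R) =
            eta * (a / eta - (- spin K m1 - spin K m2 + t%:R)).
  by field.
have tE t : - spin K m1 - spin K m2 + 1 + t%:R =
            - spin K m1 - spin K m2 + t.+1%:R.
  by rewrite -natr1; ring.
split=> [/mapP[t]|[[//|t] t_lt]].
  (* The list is indexed from 0 but begins at s = 1. *)
  rewrite mem_iota => t_lt eq_a; exists t.+1; first by lia.
  by rewrite aE eq_a tE subrr mulr0.
rewrite aE => /eqP; rewrite mulf_eq0 (negPf eta_neq0) subr_eq0 => /eqP->.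
by rewrite -tE; apply: map_f; rewrite mem_iota; lia.
Qed.

Lemma regular_Q12_coef (a : K) (l k : nat) :
  (l <= m1)%N -> (k <= m2)%N ->
  a / eta \notin exceptional_values K m1 m2 ->
  regular_at a (Q12_coef eta m1 m2 l k).
Proof.
move=> l_le k_le a_ne; rewrite /Q12_coef.
apply: regular_prod => j _; have j_lt := ltn_ord j.
rewrite (@spin_shift _ _ (m2 + l - j)); last by lia.
have [t_lt|t_ge] := ltnP (m2 + l - j) (m1 + m2).
  apply: regularM; first exact: regular_tofrac.
  apply: regular_shiftedV; apply: contraNneq a_ne => eq_a; apply/exceptionalE.
  by exists (m2 + l - j)%N => //; lia.
(* Here [l = m1] and [j = 0], and the numerator equals the denominator. *)
have -> : nat_of_ord j = 0%N by lia.
have -> : (m2 + l - 0 = m2 + m1)%N by lia.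
rewrite natrD -(spinD m1) -(spinD m2) (_ : _ - (_ + _) = - spin K m1 - spin K m2 + 0%:R).
  by rewrite divff ?shifted_neq0 // -tofrac1; apply: regular_tofrac.
by ring.
Qed.

(** A factor vanishes at s = m2 + l - (k + j) with 1 <= j <= n. Here k + j <= m2 and l >= n >= 1
    give s >= 1, while j >= 1 gives s < m1 + m2. *)
Lemma regular_denom_coef (a : K) (l k n : nat) :
  (n <= l <= m1)%N -> (k + n <= m2)%N ->
  a / eta \notin exceptional_values K m1 m2 ->
  regular_at a (denom_coef eta m1 m2 l k n).
Proof.
move=> l_le k_le a_ne; rewrite /denom_coef.
apply: regular_prod => j; rewrite mem_index_iota => j_lt.
apply: regular_shiftedV; apply: contraNneq a_ne => eq_a; apply/exceptionalE.
exists (m2 + l - (k + j))%N; first by lia.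
rewrite -(@spin_shift l (k + j)); last by lia.
by rewrite -[RHS]eq_a natrD; ring.
Qed.

Lemma F12_well_defined_nonexceptional (delta1 delta2 : K) :
  (delta1 - delta2) / eta \notin exceptional_values K m1 m2 ->
  F12_well_defined eta m1 m2 delta1 delta2.
Proof.
move=> a_ne i j; apply: regular_no_pole; rewrite F12_rationalE.
set l := (mxtens_unindex i).1; set k := (mxtens_unindex i).2.
have [l_lt k_lt] := (ltn_ord l, ltn_ord k).
apply: regularM; first exact: regular_Q12_coef.
apply: regular_sum => n _.
have [l_ltn|n_le] := ltnP l n.
  rewrite opFX_support // mulr0 mul0r rmorph0 mul0r.
  by rewrite -tofrac0; apply: regular_tofrac.
(* A nonzero entry of E^n makes k + n a column index, hence at most m2. *)
have [kn_eq|kn_neq] := eqVneq (k + n)%N (mxtens_unindex j).2; last first.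
  rewrite opEX_support // mulr0 rmorph0 mul0r.
  by rewrite -tofrac0; apply: regular_tofrac.
apply: regularM; first exact: regular_cst.
apply: regular_denom_coef => //; first by lia.
by rewrite kn_eq -ltnS ltn_ord.
Qed.

(** For n > 0 the matrix E^n has zero diagonal, and the term n = 0 is the identity. *)
Lemma F12_rational_diag i :
  F12_rational eta m1 m2 i i =
  Q12_coef eta m1 m2 (mxtens_unindex i).1 (mxtens_unindex i).2.
Proof.
rewrite F12_rationalE big_ord_recl big1 => [|n _].
  rewrite /denom_coef big_geq // !expr0 !mxE !eqxx divr1 !mulr1 rmorph1.
  by rewrite addr0 !mulr1.
by rewrite opEX_support ?mulr0 ?rmorph0 ?mul0r // lift0; lia.
Qed.

(* The zero of the denominator at [j = k - 1] is not matched by the numerator,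
   which vanishes only at the integers above [m1 + m2 - k]. *)
Lemma has_pole_Q12_coef (a : K) (l k t : nat) :
  (0 < k <= m2)%N -> (t + k = m2 + l + 1)%N -> (t + k <= m1 + m2)%N ->
  a + eta * (spin K m1 + spin K m2 - t%:R) = 0 ->
  has_pole (Q12_coef eta m1 m2 l k) a.
Proof.
move=> k_le tE t_le eq_a.
rewrite /Q12_coef prodf_div /shifted -!(rmorph_prod (@FracField.tofrac {poly K})).
apply: has_pole_frac.
- by apply/prodf_neq0=> j _; apply: poly_shifted_neq0.
- rewrite rootE horner_prod; apply/prodf_neq0 => j _.
  rewrite -rootE root_shifted; have j_lt := ltn_ord j.
  have -> : a + eta * (- spin K m1 - spin K m2 + j%:R) =
            eta * (t%:R + j%:R - (m1 + m2)%:R).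
    by rewrite -[LHS]subr0 -eq_a natrD -(spinD m1) -(spinD m2); ring.
  rewrite mulf_neq0 // -natrD subr_eq0 eqr_nat; lia.
- case: k k_le tE {t_le} => // k k_le tE; rewrite big_ord_recr rootM /=.
  by rewrite root_shifted (@spin_shift _ _ t) ?eq_a ?eqxx ?orbT //; lia.
Qed.

Lemma F12_not_well_defined (delta1 delta2 : K) :
  (0 < m1)%N -> (0 < m2)%N ->
  (delta1 - delta2) / eta \in exceptional_values K m1 m2 ->
  ~ F12_well_defined eta m1 m2 delta1 delta2.
Proof.
move=> m1_gt0 m2_gt0 /exceptionalE[t t_lt eq_a] wd.
have no_pole l k : (l <= m1)%N -> (k <= m2)%N ->
    ~ has_pole (Q12_coef eta m1 m2 l k) (delta1 - delta2).
  rewrite -[(l <= _)%N]ltnS -[(k <= _)%N]ltnS => l_lt k_lt.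
  have := wd (mxtens_index (Ordinal l_lt, Ordinal k_lt))
             (mxtens_index (Ordinal l_lt, Ordinal k_lt)).
  by rewrite F12_rational_diag mxtens_indexK.
(* The first witness meets t + k <= m1 + m2 because m1 > 0; the second has k = 1 <= m2 because m2 >
   0. *)
have [t_le|t_ge] := leqP t m2.
  by apply: (no_pole 0%N (m2 - t + 1)%N); [lia..|apply: has_pole_Q12_coef eq_a; lia].
by apply: (no_pole (t - m2)%N 1%N); [lia..|apply: has_pole_Q12_coef eq_a; lia].
Qed.

End WellDefinedness.

(* With both spins 1/2 and equal evaluation parameters, [C(eta / 2)] and
   [C(- eta / 2)] are, up to scaling, the maps
   (a, b, c, d) |-> (b, d, 0, 0) and (c, 0, d, 0), which drive any nonzero
   vector to the highest weight line; [B(eta / 2)] and [B(- eta / 2)] recover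
   the whole space from it. *)
Section IrreducibleExample.

Context {K : numFieldType}.
Variable eta : K.
Hypothesis eta_neq0 : eta != 0.

Let V : yangian_ops K (2 * 2) :=
  tensor_rep (evaluation_rep eta 1 0) (evaluation_rep eta 1 0).

(** The coordinates belong to |0,0>, |0,1>, |1,0>, |1,1>, in this order. *)
Definition col4 (a b c d : K) : 'cV[K]_(2 * 2) :=
  \col_i nth 0 [:: a; b; c; d] i.

Lemma col4E (v : 'cV[K]_(2 * 2)) : exists a b c d, v = col4 a b c d.
Proof.
exists (v (inord 0) 0), (v (inord 1) 0), (v (inord 2) 0), (v (inord 3) 0).
apply/colP=> i; rewrite !mxE.
by case: i => [[|[|[|[|i]]]] ?] //=; congr (v _ _); apply: val_inj; rewrite /= inordK.
Qed.

Lemma scale_col4 x a b c d :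
  x *: col4 a b c d = col4 (x * a) (x * b) (x * c) (x * d).
Proof.
by apply/colP=> i; rewrite !mxE; case: i => [[|[|[|[|i]]]] ?].
Qed.

Lemma add_col4 a b c d a' b' c' d' :
  col4 a b c d + col4 a' b' c' d' = col4 (a + a') (b + b') (c + c') (d + d').
Proof.
by apply/colP=> i; rewrite !mxE; case: i => [[|[|[|[|i]]]] ?].
Qed.

Lemma opC_col4 u a b c d :
  opC V u *m col4 a b c d =
  col4 (eta * ((u + eta / 2) * b + (u - eta / 2) * c))
       (eta * (u + eta / 2) * d) (eta * (u - eta / 2) * d) 0.
Proof.
apply/colP=> i; rewrite !mxE !big_ord_recl big_ord0 !mxE /= /spin.
case: i => [[|[|[|[|i]]]] ?] //=; rewrite ?mulr1n ?mulr0n; by field.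
Qed.

Lemma opB_col4 u a b c d :
  opB V u *m col4 a b c d =
  col4 0 (eta * (u - eta / 2) * a) (eta * (u + eta / 2) * a)
       (eta * ((u - eta / 2) * b + (u + eta / 2) * c)).
Proof.
apply/colP=> i; rewrite !mxE !big_ord_recl big_ord0 !mxE /= /spin.
case: i => [[|[|[|[|i]]]] ?] //=; rewrite ?mulr1n ?mulr0n; by field.
Qed.

Lemma irreducible_equal_parameters : irreducible_rep V.
Proof.
move=> W invW.
have memZ x v : x != 0 -> x *: v \in W -> v \in W.
  by move=> x0; rewrite rpredZeq (negPf x0).
(* At u = eta / 2 or - eta / 2 one of the factors u - eta / 2, u + eta / 2 vanishes; the other
   leaves the common scalar eta^2 or - eta^2. *)
have C1 a b c d : col4 a b c d \in W -> col4 b d 0 0 \in W.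
  move=> vW; have [_ _ + _] := invW (eta / 2); move=> /(_ _ vW).
  rewrite opC_col4 => CvW; apply: (memZ (eta ^+ 2)); first exact: expf_neq0.
  by move: CvW; rewrite scale_col4; congr (col4 _ _ _ _ \in W); field.
have C2 a b c d : col4 a b c d \in W -> col4 c 0 d 0 \in W.
  move=> vW; have [_ _ + _] := invW (- eta / 2); move=> /(_ _ vW).
  rewrite opC_col4 => CvW; apply: (memZ (- eta ^+ 2)).
    by rewrite oppr_eq0 expf_neq0.
  by move: CvW; rewrite scale_col4; congr (col4 _ _ _ _ \in W); field.
have B1 a b c d : col4 a b c d \in W -> col4 0 0 a c \in W.
  move=> vW; have [_ + _ _] := invW (eta / 2); move=> /(_ _ vW).
  rewrite opB_col4 => BvW; apply: (memZ (eta ^+ 2)); first exact: expf_neq0.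
  by move: BvW; rewrite scale_col4; congr (col4 _ _ _ _ \in W); field.
have B2 a b c d : col4 a b c d \in W -> col4 0 a 0 b \in W.
  move=> vW; have [_ + _ _] := invW (- eta / 2); move=> /(_ _ vW).
  rewrite opB_col4 => BvW; apply: (memZ (- eta ^+ 2)).
    by rewrite oppr_eq0 expf_neq0.
  by move: BvW; rewrite scale_col4; congr (col4 _ _ _ _ \in W); field.
have [->|W_neq0] := eqVneq W 0%VS; [by left|right].
(* Test d, b, c in turn: the first nonzero one is moved to the top coordinate; if all vanish, a
   remains. *)
have [x x_neq0 xW] : exists2 x, x != 0 & col4 x 0 0 0 \in W.
  have [a [b [c [d vE]]]] := col4E (vpick W).
  have := memv_pick W; rewrite vE => vW.
  have [d0|d_neq0] := eqVneq d 0; last first.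
    by exists d => //; exact: (C1 _ _ _ _ (C1 _ _ _ _ vW)).
  have [b0|b_neq0] := eqVneq b 0; last first.
    by exists b => //; move: (C1 _ _ _ _ vW); rewrite d0.
  have [c0|c_neq0] := eqVneq c 0; last first.
    by exists c => //; move: (C2 _ _ _ _ vW); rewrite d0.
  exists a; last by move: vW; rewrite b0 c0 d0.
  apply: contraNneq W_neq0 => a0; rewrite -vpick0 vE a0 b0 c0 d0.
  by apply/eqP/colP=> i; rewrite !mxE; case: i => [[|[|[|[|i]]]] ?].
have e2 := B2 _ _ _ _ xW; have e3 := B1 _ _ _ _ xW; have e4 := B2 _ _ _ _ e2.
apply/vspaceP=> v; rewrite memvf.
have [a [b [c [d ->]]]] := col4E v.
have -> : col4 a b c d = (a / x) *: col4 x 0 0 0 + (b / x) *: col4 0 x 0 0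
           + (c / x) *: col4 0 0 x 0 + (d / x) *: col4 0 0 0 x.
  by rewrite !scale_col4 !add_col4 !mulr0 !addr0 !add0r !divfK.
by rewrite !rpredD ?rpredZ.
Qed.

End IrreducibleExample.

(** If one spin is 0, F_12 is the identity, yet the exceptional set is nonempty once m1 + m2 >= 2;
    the equivalence is therefore stated away from that case. *)
Theorem corollary5p5 (R : realType) (eta : R[i]) (eta_neq0 : eta != 0) :
  [/\ forall (m1 m2 : nat) (delta1 delta2 : R[i]),
        ((0 < m1)%N /\ (0 < m2)%N) \/ (m1 + m2 <= 1)%N ->
        (F12_well_defined eta m1 m2 delta1 delta2 <->
         (delta1 - delta2) / eta \notin exceptional_values R[i] m1 m2),
      forall (m1 m2 : nat) (delta1 delta2 : R[i]),
        (delta1 - delta2) / eta \notin exceptional_values R[i] m1 m2 ->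
        F12_well_defined eta m1 m2 delta1 delta2
    & exists (m1 m2 : nat) (delta1 delta2 : R[i]),
        irreducible_rep (tensor_rep (evaluation_rep eta m1 delta1)
                                    (evaluation_rep eta m2 delta2)) /\
        ~ F12_well_defined eta m1 m2 delta1 delta2].
Proof.
split=> [m1 m2 delta1 delta2 m_cond|m1 m2 delta1 delta2|].
- split=> [wd|]; last exact: F12_well_defined_nonexceptional.
  case: m_cond => [[m1_gt0 m2_gt0]|m_le1].
    by apply/negP=> /(F12_not_well_defined _ _ _ eta_neq0 _ _ m1_gt0 m2_gt0).
  by apply/negP=> /(exceptionalE _ _ _ eta_neq0)[t]; lia.
- exact: F12_well_defined_nonexceptional.
(* For two spins 1/2 the only exceptional value is 0, that is s = 1. *)
exists 1%N, 1%N, 0, 0; split; first exact: irreducible_equal_parameters.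
apply: F12_not_well_defined => //; apply/exceptionalE => //.
by exists 1%N => //; rewrite spinD !subrr mulr0 addr0.
Qed.
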